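(* The stationary distribution under balanced fairness, $$\pi^{\mathrm{BF}}(x)=\frac1Z\exp\Big(-\phi(x)+\sum_{r\in\mathcal{R}}x_r\log(\rho_r)\Big)$$ with $Z$ a normalization constant, admits the following large deviations asymptotics: $$\lim_{n\to\infty}\frac1n\log\pi^{\mathrm{BF}}(nx)=-L(x),\qquad x\in\mathbb{R}_+^{\mathcal{R}},$$ where $L(x)=\delta_K^*(x)-\sum_{r\in\mathcal{R}}\log(\rho_r)x_r$ is the function that serves as Lyapunov function in the study of stability properties of proportional fairness. It thus admits the same large deviations characteristics as the stationary distribution $\pi^{\mathrm{PF}'}(x)=\exp(-L(x))$ (given up to normalization) of the system under modified proportionally fair (PF$'$) sharing.
   Context: $\mathcal{R}$ is a finite set (of user types); $e_r$ is the $r$-th unit vector of $\mathbb{R}^{\mathcal{R}}$. The capacity set $\mathcal{C}\subset\mathbb{R}_+^{\mathcal{R}}$ is convex and nonincreasing (if $\lambda,\lambda'\in\mathbb{R}_+^{\mathcal{R}}$, $\lambda_r\le\lambda'_r$ for all $r\in\mathcal{R}$ and $\lambda'\in\mathcal{C}$, then $\lambda\in\mathcal{C}$). The set $K\subset\mathbb{R}^{\mathcal{R}}$ is defined by $\gamma\in K\Leftrightarrow(e^{\gamma_r})_{r\in\mathcal{R}}\in\mathcal{C}$; $\delta_K$ equals $0$ on $K$ and $+\infty$ outside $K$; $\delta_K^*(x)=\sup_{\gamma\in\mathbb{R}^{\mathcal{R}}}(\langle\gamma,x\rangle-\delta_K(\gamma))$. The balance function $\psi$ is defined by induction on $\mathbb{Z}_+^{\mathcal{R}}$,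 starting from $\psi(0)=1$, $\psi(x)=0$ for any $x$ not in $\mathbb{R}_+^{\mathcal{R}}$, and $\psi(x)=\inf\{a>0:(a^{-1}\psi(x-e_r))_{r\in\mathcal{R}}\in\mathcal{C}\}$; $\phi(x)=-\log\psi(x)$. The balanced fairness allocation is $\lambda_r^{\mathrm{BF}}(x)=\psi(x-e_r)/\psi(x)$. The PF$'$ allocation is $\lambda_r^{\mathrm{PF}'}(x)=\exp(\delta_K^*(x)-\delta_K^*(x-e_r))$ if $x_r>0$, and $0$ otherwise. Under an allocation $\lambda$, the system is the Markov process on $\mathbb{Z}_+^{\mathcal{R}}$ with transition rates $x\to x+e_r$: $\nu_r$ and $x\to x-e_r$: $\mu_r\lambda_r(x)$, and $\rho_r=\nu_r/\mu_r$. *)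

(* Defs.v *)
From HB Require Import structures.
From mathcomp Require Import all_boot all_order all_algebra.
From mathcomp Require Import all_classical all_reals all_analysis.

Set Implicit Arguments.
Unset Strict Implicit.
Unset Printing Implicit Defensive.

Import Order.TTheory GRing.Theory Num.Theory.
Import numFieldNormedType.Exports.

Local Open Scope classical_set_scope.
Local Open Scope ring_scope.

Section States.
Variables (R : realType) (U : finType).

Definition vec := {ffun U -> R^o}.

Definition state := {ffun U -> nat}.

Definition add_user (x : state) (r : U) : state :=
  [ffun s => (x s + (s == r))%N].

(* This is x - e_r only when 0 < x r: the subtraction truncates. *)
Definition del_user (x : state) (r : U) : state :=
  [ffun s => (x s - (s == r))%N].

Definition vec_of (x : state) : vec := [ffun r => (x r)%:R].

(* The lattice point floor (n x), coordinatewise; it is n x itself whenever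
   n x is integral. *)
Definition scaled_state (n : nat) (x : vec) : state :=
  [ffun r => Num.truncn (n%:R * x r)].

Definition inner (u v : vec) : R := \sum_(r : U) u r * v r.

End States.

Section Capacity.
Local Open Scope ereal_scope.
Variables (R : realType) (U : finType) (C : set (vec R U)).

Definition nonincreasing_capacity :=
  forall l l' : vec R U, (forall r, (0 <= l r)%R) -> (forall r, (0 <= l' r)%R) ->
    (forall r, (l r <= l' r)%R) -> C l' -> C l.

Definition log_capacity : set (vec R U) :=
  [set g | C [ffun r => expR (g r)]].

Definition indicator_fun (A : set (vec R U)) (g : vec R U) : \bar R :=
  if `[< A g >] then 0 else +oo.

Definition convex_conjugate (f : vec R U -> \bar R) (x : vec R U) : \bar R :=
  ereal_sup [set (inner g x)%:E - f g | g in [set: vec R U]].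

Definition support_K : vec R U -> \bar R :=
  convex_conjugate (indicator_fun log_capacity).

(* The value of f at x - e_r, f being extended by 0 outside the orthant. *)
Definition before (f : state U -> \bar R) (x : state U) (r : U) : \bar R :=
  if x r == 0%N then 0 else f (del_user x r).

(* The infimum is taken in [0, +oo]. The values f (x - e_r) may be infinite,
   in which case (a^-1 f (x - e_r))_r is not a vector of reals, hence is not
   in C. *)
Definition balance_step (f : state U -> \bar R) (x : state U) : \bar R :=
  ereal_inf [set a%:E | a in [set a : R | (0 < a)%R /\
    exists2 l : vec R U, C l & forall r, (l r)%:E = a^-1%:E * before f x r]].

(* The counter n only makes the recursion structural, see balanceE. *)
Fixpoint balance_rec (n : nat) (x : state U) : \bar R :=
  if x == [ffun=> 0%N] then 1
  else if n is m.+1 then balance_step (balance_rec m) x else 0.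

Definition balance (x : state U) : \bar R :=
  balance_rec (\sum_(r : U) x r)%N x.

Lemma balance0 : balance [ffun=> 0%N] = 1.
Proof. by rewrite /balance; case: (\sum_(r : U) _)%N => [|n] /=; rewrite eqxx. Qed.

Lemma sum_del_user (x : state U) r : x r != 0%N ->
  (\sum_(s : U) x s)%N = (\sum_(s : U) del_user x r s).+1.
Proof.
move=> xr; rewrite (bigD1 r)//= [in RHS](bigD1 r)//= ffunE eqxx.
rewrite (eq_bigr (del_user x r)); last first.
  by move=> s /negPf sr; rewrite ffunE sr subn0.
by rewrite -addSn; case: (x r) xr => // k _; rewrite subn1.
Qed.

Lemma balanceE (x : state U) : x != [ffun=> 0%N] ->
  balance x = balance_step balance x.
Proof.
move=> x0; rewrite {1}/balance.
have [r xr] : exists r, x r != 0%N.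
  apply/existsP; apply: contraNT x0; rewrite negb_exists => /forallP h.
  by apply/eqP/ffunP => r; rewrite ffunE; move: (h r); rewrite negbK => /eqP.
rewrite (sum_del_user xr)/= (negPf x0) /balance_step.
suff -> : before (balance_rec (\sum_(s : U) del_user x r s)%N) x = before balance x by [].
apply/funext => s; rewrite /before; case: ifPn => // xs.
by rewrite /balance; congr balance_rec; apply: succn_inj; rewrite -!sum_del_user.
Qed.

Definition phi (x : state U) : \bar R := - lne (balance x).

(* A genuine quotient only when balance x is positive: otherwise the extended
   division returns the junk value 0 for 0 / 0. *)
Definition lambda_BF (x : state U) (r : U) : \bar R :=
  before balance x r / balance x.

(* Likewise, the exponent is only meaningful when support_K is finite. *)
Definition lambda_PF' (x : state U) (r : U) : \bar R :=
  if (0 < x r)%N then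
    expeR (support_K (vec_of R x) - support_K (vec_of R (del_user x r)))
  else 0.

End Capacity.

Section Markov.
Local Open Scope ereal_scope.
Variables (R : realType) (U : finType) (nu mu : U -> R).
Variable lambda : state U -> U -> \bar R.

(* For fixed x and y at most one of the summands is nonzero. *)
Definition jump_rate (x y : state U) : \bar R :=
  \sum_(r | y == add_user x r) (nu r)%:E +
  \sum_(r | x == add_user y r) (mu r)%:E * lambda x r.

Definition stationary_distribution (p : state U -> \bar R) :=
  [/\ forall x, 0 <= p x,
      \esum_(x in [set: state U]) p x = 1 &
      forall y, \esum_(x in [set~ y]) (p x * jump_rate x y) =
                p y * \esum_(z in [set~ y]) jump_rate y z].

End Markov.

Section Distributions.
Local Open Scope ereal_scope.
Variables (R : realType) (U : finType) (C : set (vec R U)) (rho : U -> R).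

Definition lyapunov (x : vec R U) : \bar R :=
  support_K C x - (\sum_(r : U) ln (rho r) * x r)%:E.

Definition weight_BF (x : state U) : \bar R :=
  expeR (- phi C x + (\sum_(r : U) (x r)%:R * ln (rho r))%:E).

Definition weight_PF' (x : state U) : \bar R := expeR (- lyapunov (vec_of R x)).

Definition normalization (w : state U -> \bar R) : \bar R :=
  \esum_(x in [set: state U]) w x.

(* The reciprocal is only meaningful when the normalization is finite. *)
Definition normalized (w : state U -> \bar R) (x : state U) : \bar R :=
  (normalization w)^-1 * w x.

Definition pi_BF := normalized weight_BF.

Definition pi_PF' := normalized weight_PF'.

Definition large_deviations (p : state U -> \bar R) (I : vec R U -> \bar R) :=
  forall x : vec R U, (forall r, (0 <= x r)%R) ->
    (n%:R^-1)%:E * lne (p (scaled_state n x)) @[n --> \oo] --> - I x.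

End Distributions.

(* Main.v *)
(** Write psi for the balance function and d for the support function of K. By
    induction psi(y) <= exp(-<g, y>) for g in K, so psi <= exp(-d). Conversely, a
    linear constraint sum_r b_r l_r <= 1 valid on C yields
    psi(y) >= |y|! prod_r b_r^(y_r) / y_r!. The first-order optimality condition of
    a near maximizer g of <., y> on K provides the constraint
    b_r = y_r exp(-g_r) / (|y| + 1), and elementary factorial bounds turn this into
    psi(y) >= exp(-d(y)) up to a factor polynomial in y. Hence psi and exp(-d) have
    the same exponential rate, which is d(x) along floor(n x). Stationarity follows
    from detailed balance. *)

Require Import Defs.
From mathcomp Require Import all_boot all_order all_algebra.
From mathcomp Require Import all_classical all_reals all_analysis.
From mathcomp Require Import ring lra.

Import Order.TTheory GRing.Theory Num.Theory.
Import numFieldNormedType.Exports.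

Local Open Scope classical_set_scope.
Local Open Scope ring_scope.

Set Implicit Arguments.
Unset Strict Implicit.

(** * Elementary estimates *)

(** Apply [ln (1 + t) <= t] to [(1 + z)^-1], then use [(1 + z) (1 - z + 2 z^2) = 1 + z^2 (1 + 2 z)
    >= 1]. *)
Lemma ln1Dx_ge (R : realType) (z : R) : - 2^-1 <= z -> z - 2 * z ^+ 2 <= ln (1 + z).
Proof.
move=> hz; have z1 : 0 < 1 + z by lra.
have : ln (1 + z)^-1 <= (1 + z)^-1 - 1.
  by apply: le_trans (le_ln1Dx _); [rewrite addrCA subrr addr0 | have := z1; rewrite -invr_gt0; lra].
rewrite lnV// => h.
suff : (1 + z)^-1 <= 1 - z + 2 * z ^+ 2 by lra.
rewrite invf_ple ?posrE//; last by nra.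
rewrite -[X in X <= _]mul1r ler_pdivrMr; last by nra.
by nra.
Qed.

(** A crude Stirling bound with polynomial loss. The factor [n.+1] covers [n = 0]; for [n > 0] the
    induction runs with the factor [n], and its step is [(1 + 1/n)^(n+1) >= e]. *)
Lemma factorial_le (R : realType) (n : nat) :
  n`!%:R * expR n%:R <= expR 1 * n.+1%:R * n%:R ^+ n :> R.
Proof.
case: n => [|n].
  by rewrite fact0 !mul1r expr0 !mulr1 ler_expR.
suff h : n.+1`!%:R * expR n.+1%:R <= expR 1 * n.+1%:R * n.+1%:R ^+ n.+1 :> R.
  apply: le_trans h _; rewrite ler_wpM2r ?exprn_ge0// ler_wpM2l ?expR_ge0//.
  by rewrite ler_nat.
elim: n => [|n IH]; first by rewrite expr1n !mulr1 mul1r.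
have [a aE] : exists a, a = n.+1%:R :> R by exists n.+1%:R.
have a0 : 0 < a by rewrite aE ltr0n.
have bE : n.+2%:R = a + 1 by rewrite aE natr1.
rewrite -aE in IH.
have key : expR 1 * a ^+ n.+2 <= (a + 1) ^+ n.+2.
  have : expR 1 <= (1 + a^-1) ^+ n.+2.
    rewrite -[X in _ <= X ^+ _]lnK ?posrE; last by rewrite ltr_wpDr ?invr_ge0 ?ltW.
    rewrite -expRM_natl ler_expR bE.
    have : ln (1 + a^-1)^-1 <= (1 + a^-1)^-1 - 1.
      apply: le_trans (le_ln1Dx _); first by rewrite addrCA subrr addr0.
      by rewrite ltrBrDl subrr invr_gt0 ltr_wpDr ?invr_ge0 ?ltW.
    have e1 : 1 + a^-1 = (a + 1) / a by field; rewrite gt_eqF.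
    rewrite e1 lnV ?posrE ?divr_gt0 ?addr_gt0// invf_div => h.
    have : (a + 1)^-1 <= ln ((a + 1) / a).
      suff -> : (a + 1)^-1 = 1 - a / (a + 1) by rewrite lerNl opprB in h.
      by field; rewrite gt_eqF ?addr_gt0.
    by rewrite -[X in X <= _]mul1r ler_pdivrMr ?addr_gt0// mulrC.
  rewrite -(ler_pM2r (exprn_gt0 n.+2 a0)) => /le_trans; apply.
  by rewrite -exprMn mulrDl mul1r mulVf ?gt_eqF.
rewrite factS natrM !bE expRD.
have -> : (a + 1) * n.+1`!%:R * (expR a * expR 1) =
  (a + 1) * expR 1 * (n.+1`!%:R * expR a) by ring.
have c0 : 0 <= (a + 1) * expR 1 by rewrite mulr_ge0 ?expR_ge0 ?addr_ge0 ?ltW.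
apply: le_trans (ler_wpM2l c0 IH) _.
have -> : (a + 1) * expR 1 * (expR 1 * a * a ^+ n.+1) =
  (a + 1) * expR 1 * (expR 1 * a ^+ n.+2) by rewrite (exprS a n.+1); ring.
by apply: le_trans (ler_wpM2l c0 key) _; rewrite [_ * expR 1]mulrC.
Qed.

(** [(n+1)^n / n! = (n+1)^(n+1) / (n+1)!] is a single term of the series of [exp (n+1)]. *)
Lemma exprSn_le_factorial (R : realType) (n : nat) :
  n.+1%:R ^+ n <= n`!%:R * expR n.+1%:R :> R.
Proof.
have h : 1 + n.+1%:R ^+ n.+1 / n.+1`!%:R <= expR n.+1%:R :> R.
  by apply: expR_ge1Dxn; rewrite ler0n.
have f0 : 0 < n`!%:R :> R by rewrite ltr0n fact_gt0.
have /ltW : n.+1%:R ^+ n / n`!%:R < expR n.+1%:R :> R.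
  apply: lt_le_trans h; rewrite factS natrM exprS invfM mulrACA divff ?pnatr_eq0//.
  by rewrite mul1r ltrDr.
by rewrite ler_pdivrMr// mulrC.
Qed.


(** * Support function of the log-capacity set *)

Section SupportFunction.
Variables (R : realType) (U : finType) (C : set (vec R U)).

Lemma support_K_ge (g x : vec R U) :
  log_capacity C g -> ((inner g x)%:E <= support_K C x)%E.
Proof.
move=> Kg; apply: ereal_sup_ubound; exists g => //.
by rewrite /indicator_fun; case: asboolP => // _; rewrite sube0.
Qed.

Lemma support_K_le (x : vec R U) (a : \bar R) :
  (forall g, log_capacity C g -> ((inner g x)%:E <= a)%E) ->
  (support_K C x <= a)%E.
Proof.
move=> h; apply: ge_ereal_sup => _ [g _ <-].
rewrite /indicator_fun; case: asboolP => [Kg|_]; last by rewrite leNye.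
by rewrite sube0; exact: h.
Qed.

Hypothesis C_nonneg : forall l : vec R U, C l -> forall r, 0 <= l r.
Hypothesis C_convex : convex_set C.
Hypothesis C_nonincreasing : nonincreasing_capacity C.

Lemma capacity_segment (l m : vec R U) (t : R) : 0 <= t -> t <= 1 ->
  C l -> C m -> C [ffun r => t * m r + (1 - t) * l r].
Proof.
move=> t0 t1 Cl Cm; have := C_convex (Itv01 t0 t1) (mem_set Cm) (mem_set Cl).
move=> /set_mem; congr C; apply/ffunP => r; rewrite ffunE.
by rewrite /conv /= /isConvexSpace.conv /= ffunE/= !ffunE.
Qed.

Lemma log_capacity_exists : C !=set0 ->
  (forall r, exists2 l, C l & 0 < l r) -> log_capacity C !=set0.
Proof.
move=> [l0 Cl0] h.
(* Averaging in one witness at a time keeps the coordinates that are already positive, since [C]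
   lies in the orthant. *)
suff [l Cl lp] : exists2 l : vec R U, C l & forall r, r \in enum U -> 0 < l r.
  exists [ffun r => ln (l r)]; rewrite /log_capacity /=.
  suff -> : [ffun r => expR ([ffun r0 => ln (l r0)] r)] = l :> vec R U by [].
  by apply/ffunP => r; rewrite !ffunE lnK// posrE lp// mem_enum.
elim: (enum U) => [|r s [l Cl lp]]; first by exists l0.
have [m Cm mp] := h r.
have h0 : 0 <= 2^-1 :> R by rewrite invr_ge0.
have h1 : 2^-1 <= 1 :> R by lra.
exists [ffun r => 2^-1 * m r + (1 - 2^-1) * l r]; first exact: capacity_segment.
move=> r'; rewrite inE ffunE => /orP[/eqP ->|/lp lr].
  by have := C_nonneg Cl r; lra.
by have := C_nonneg Cm r'; lra.
Qed.

(* A nearly optimal [g] works: otherwise moving [exp g] towards some [m] gains a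
   definite amount on [inner g y]. Since [C] is nonincreasing, the ratios
   [m r / exp (g r)] may be capped at [N + 2], which makes the step uniform. *)
Lemma log_capacity_near_optimal (y : state U) : log_capacity C !=set0 ->
  (support_K C (vec_of R y) < +oo)%E ->
  exists2 g : vec R U, log_capacity C g &
    forall m, C m -> \sum_r (y r)%:R * (m r * expR (- g r)) <=
      (\sum_r y r)%N.+1%:R.
Proof.
move=> [g0 Kg0] fin; set N := (\sum_r y r)%N.
have finD : support_K C (vec_of R y) \is a fin_num.
  by rewrite fin_numElt fin (lt_le_trans _ (support_K_ge _ Kg0)) ?ltNyr.
have [D DE] : exists D, support_K C (vec_of R y) = D%:E.
  by exists (fine (support_K C (vec_of R y))); rewrite fineK.
have leD g : log_capacity C g -> inner g (vec_of R y) <= D.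
  by move=> /support_K_ge -/(_ (vec_of R y)); rewrite DE lee_fin.
have [n nE] : exists n, n = N%:R :> R by exists N%:R.
have n0 : 0 <= n by rewrite nE ler0n.
pose B : R := n + 2.
have B0 : 2 <= B by rewrite /B; lra.
have nB0 : 0 <= n * B ^+ 2 by rewrite mulr_ge0// sqr_ge0.
(* The step [t] makes the second-order loss [2 t^2 B^2 n] at most [t / 2]; also [t <= 1/2] keeps [z]
   below in the range of [ln1Dx_ge]. *)
pose t : R := (4 * (n * B ^+ 2) + 2)^-1.
have d0 : 0 < 4 * (n * B ^+ 2) + 2 by lra.
have t0 : 0 < t by rewrite invr_gt0.
have t12 : t <= 2^-1 by rewrite lef_pV2 ?posrE//; lra.
have tB : 4 * (n * B ^+ 2) * t <= 1.
  have : (4 * (n * B ^+ 2) + 2) * t = 1 by rewrite mulfV// gt_eqF.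
  by lra.
have sN : \sum_r (y r)%:R = n by rewrite nE /N natr_sum.
apply: contrapT => H.
have {}H g : log_capacity C g -> exists2 m, C m &
    n + 1 < \sum_r (y r)%:R * (m r * expR (- g r)).
  move=> Kg; apply: contrapT => H'; apply: H; exists g => // m Cm.
  rewrite -natr1 -nE leNgt; apply/negP => lt; apply: H'; by exists m.
(* A slack of [t / 4] is enough: the move below gains at least [t / 2]. *)
have [g Kg gD] : exists2 g, log_capacity C g & D - t / 4 < inner g (vec_of R y).
  apply: contrapT => H'.
  suff : (support_K C (vec_of R y) <= (D - t / 4)%:E)%E by rewrite DE lee_fin; lra.
  apply: support_K_le => g Kg; rewrite lee_fin leNgt; apply/negP => lt.
  by apply: H'; exists g.
have [m Cm mS] := H g Kg.
pose u r := Num.min (m r * expR (- g r)) B.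
have u0 r : 0 <= u r.
  by rewrite /u le_min mulr_ge0 ?expR_ge0 ?C_nonneg//=; lra.
have uB r : u r <= B by rewrite /u ge_min lexx orbT.
(* A capped coordinate with [y r >= 1] contributes at least [n + 2] by itself; if there is none,
   capping changes no term of the sum. *)
have Su : n + 1 <= \sum_r (y r)%:R * u r.
  have [[r yr mB]|nex] := pselect (exists2 r, y r != 0%N & B < m r * expR (- g r)).
    rewrite (bigD1 r)//= -[X in X <= _]addr0 lerD//; last first.
      by apply: sumr_ge0 => s _; rewrite mulr_ge0.
    have -> : u r = B by rewrite /u min_r// ltW.
    have : 1 <= (y r)%:R :> R by rewrite ler1n lt0n.
    by rewrite /B; nra.
  apply: ltW; apply: lt_le_trans mS _; apply: ler_sum => r _.
  have [->|yr] := eqVneq (y r) 0%N; first by rewrite !mul0r.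
  rewrite /u min_l// leNgt; apply/negP => lt; apply: nex; by exists r.
pose z r := t * (u r - 1).
have zlow r : - 2^-1 <= z r by rewrite /z; have := u0 r; nra.
have z1 r : 0 < 1 + z r by have := zlow r; lra.
pose g' : vec R U := [ffun r => g r + ln (1 + z r)].
(* [exp g' = exp g (1 + t (u - 1))] lies below the point [(1 - t) exp g + t m] of [C]. *)
have Kg' : log_capacity C g'.
  have /= := capacity_segment (ltW t0) _ Kg Cm.
  have t1 : t <= 1 by lra.
  move=> /(_ t1); apply: C_nonincreasing => r; rewrite !ffunE ?expR_ge0//.
    rewrite addr_ge0 ?mulr_ge0 ?expR_ge0 ?C_nonneg//; lra.
  rewrite expRD lnK ?posrE//.
  have : expR (g r) * u r <= m r.
    have -> : m r = expR (g r) * (m r * expR (- g r)).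
      by rewrite mulrCA -expRD subrr expR0 mulr1.
    by rewrite ler_wpM2l ?expR_ge0// /u ge_min lexx.
  rewrite /z; have := expR_gt0 (g r).
  by nra.
have := leD _ Kg'.
suff : inner g (vec_of R y) + t / 2 <= inner g' (vec_of R y) by lra.
have -> : inner g' (vec_of R y) =
    inner g (vec_of R y) + \sum_r (y r)%:R * ln (1 + z r).
  rewrite /inner -big_split /=; apply: eq_bigr => r _.
  by rewrite !ffunE mulrDl [ln _ * _]mulrC.
rewrite lerD2l.
(* The first-order gain [t (\sum_r y_r u_r - n)] is at least [t], of which the quadratic loss takes
   at most half. *)
apply: (@le_trans _ _ (\sum_r (t * ((y r)%:R * u r - (y r)%:R) - 2 * t ^+ 2 * B ^+ 2 * (y r)%:R))).
  rewrite sumrB -mulr_sumr sumrB -mulr_sumr sN.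
  nra.
apply: ler_sum => r _.
have h : z r - 2 * t ^+ 2 * B ^+ 2 <= ln (1 + z r).
  apply: le_trans (ln1Dx_ge (zlow r)).
  have : (u r - 1) ^+ 2 <= B ^+ 2 by have := u0 r; have := uB r; nra.
  by rewrite /z exprMn; have := sqr_ge0 t; nra.
have y0 : 0 <= (y r)%:R :> R by [].
by have := ler_wpM2l y0 h; rewrite /z; lra.
Qed.

End SupportFunction.


(** * Bounds on the balance function *)

Section Balance.
Variables (R : realType) (U : finType) (C : set (vec R U)).

Lemma state_ind (P : state U -> Prop) :
  P [ffun=> 0%N] ->
  (forall y : state U, y != [ffun=> 0%N] ->
    (forall r, y r != 0%N -> P (del_user y r)) -> P y) ->
  forall y, P y.
Proof.
move=> P0 PS y; move: {2}(\sum_r y r)%N (erefl (\sum_r y r)%N) => n.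
elim: n y => [|n IH] y ysum.
  suff -> : y = [ffun=> 0%N] by [].
  apply/ffunP => r; rewrite ffunE; apply/eqP; move/eqP: ysum.
  by rewrite sum_nat_eq0 => /forallP/(_ r).
have [->//|y0] := eqVneq y [ffun=> 0%N].
by apply: PS => // r yr; apply: IH; move: ysum; rewrite (sum_del_user yr) => -[].
Qed.

Lemma inner_del_user (g : vec R U) (y : state U) r : y r != 0%N ->
  inner g (vec_of R y) = inner g (vec_of R (del_user y r)) + g r.
Proof.
move=> yr; rewrite /inner (bigD1 r)//= [in RHS](bigD1 r)//= !ffunE eqxx.
rewrite (eq_bigr (fun s => g s * (vec_of R (del_user y r)) s)); last first.
  by move=> s /negPf sr; rewrite !ffunE sr subn0.
by rewrite natrB ?lt0n//=; ring.
Qed.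

Lemma balance_ge0 (y : state U) : (0 <= balance C y)%E.
Proof.
have [->|y0] := eqVneq y [ffun=> 0%N]; first by rewrite balance0.
rewrite balanceE//; apply: le_ereal_inf_tmp => _ [a [a0 _] <-].
by rewrite lee_fin ltW.
Qed.

Lemma before_ge0 (y : state U) r : (0 <= before (balance C) y r)%E.
Proof. by rewrite /before; case: ifP => // _; exact: balance_ge0. Qed.

Hypothesis C_nonneg : forall l : vec R U, C l -> forall r, 0 <= l r.
Hypothesis C_nonincreasing : nonincreasing_capacity C.

(** The value [a = exp (- <g, y>)] is admissible in the infimum: by induction
    [psi (y - e_r) <= a exp (g_r)], so [a^-1 psi (y - e_r)] lies below [exp g], a point of [C]. *)
Lemma balance_le (g : vec R U) (y : state U) : log_capacity C g ->
  (balance C y <= (expR (- inner g (vec_of R y)))%:E)%E.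
Proof.
move=> Kg; elim/state_ind: y => [|y y0 IH].
  rewrite balance0 lee_fin /inner big1 ?oppr0 ?expR0// => r _.
  by rewrite !ffunE mulr0.
rewrite balanceE//; apply: ge_ereal_inf.
set a := expR _; have a0 : 0 < a by rewrite expR_gt0.
have bound r : (before (balance C) y r <= (a * expR (g r))%:E)%E.
  rewrite /before; case: ifPn => [_|yr].
    by rewrite lee_fin mulr_ge0 ?expR_ge0.
  by apply: le_trans (IH r yr) _; rewrite /a (inner_del_user g yr) -expRD opprD subrK.
have bfin r : before (balance C) y r \is a fin_num.
  by rewrite ge0_fin_numE ?before_ge0// (le_lt_trans (bound r)) ?ltry.
exists a%:E => //; exists a => //; split=> //.
exists [ffun r => a^-1 * fine (before (balance C) y r)]; last first.
  by move=> r; rewrite ffunE EFinM fineK.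
apply: C_nonincreasing Kg => r; rewrite !ffunE ?expR_ge0//.
  by rewrite mulr_ge0 ?invr_ge0 ?(ltW a0)// fine_ge0// before_ge0.
by rewrite mulrC ler_pdivrMr// mulrC -lee_fin fineK.
Qed.

(** The term of [b^y] in the multinomial expansion of [(\sum_r b_r)^|y|]. It is the balance function
    of the part of the orthant where [\sum_r b_r l_r <= 1]. *)
Definition multinomial_weight (b : U -> R) (y : state U) : R :=
  (\sum_r y r)%N`!%:R * \prod_r (b r ^+ y r / (y r)`!%:R).

(** Summed over [r], this is Pascal's rule for multinomial coefficients; keeping the coordinates
    apart allows a termwise comparison in [balance_ge]. *)
Lemma multinomial_weight_del (b : U -> R) (y : state U) r : y r != 0%N ->
  b r * multinomial_weight b (del_user y r) * (\sum_s y s)%N%:R =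
  (y r)%:R * multinomial_weight b y.
Proof.
move=> yr; rewrite /multinomial_weight (sum_del_user yr) factS natrM.
move: (\sum_s del_user y r s)%N => n.
rewrite (bigD1 r)//= [in RHS](bigD1 r)//= !ffunE eqxx.
rewrite (eq_bigr (fun s => b s ^+ y s / (y s)`!%:R)); last first.
  by move=> s /negPf sr; rewrite !ffunE sr subn0.
case: (y r) yr => // k _; rewrite subn1 /= exprS factS natrM.
field.
by rewrite nat1r !pnatr_eq0 -lt0n fact_gt0.
Qed.

(* A linear constraint on [C] containing [a^-1 (psi (y - e_r))_r] reads
   [\sum_r b_r psi (y - e_r) <= a], whose extremal case is the recursion of the
   multinomial coefficients. *)
Lemma balance_ge (b : U -> R) (y : state U) : (forall r, 0 <= b r) ->
  (forall m, C m -> \sum_r b r * m r <= 1) ->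
  ((multinomial_weight b y)%:E <= balance C y)%E.
Proof.
move=> b0 bC; elim/state_ind: y => [|y y0 IH].
  rewrite balance0 lee_fin /multinomial_weight !big1 ?mulr1//= => r _.
    by rewrite ffunE expr0 divr1.
  by rewrite ffunE.
rewrite balanceE//; apply: le_ereal_inf_tmp => _ [a [a0 [l Cl lE]] <-].
rewrite lee_fin.
have N0 : 0 < (\sum_s y s)%N%:R :> R.
  rewrite ltr0n lt0n; apply: contraNneq y0 => /eqP; rewrite sum_nat_eq0 => /forallP h.
  by apply/eqP/ffunP => r; rewrite ffunE; exact/eqP/h.
(* Summing over [r] and dividing by [|y|] will leave the weight below [a \sum_r b_r l_r <= a].
   Coordinates with [y r = 0] only need [l r >= 0]. *)
have key r : (y r)%:R * multinomial_weight b y <=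
    (\sum_s y s)%N%:R * a * (b r * l r).
  have [->|yr] := eqVneq (y r) 0%N.
    by rewrite mul0r !mulr_ge0 ?(ltW N0) ?(ltW a0) ?C_nonneg.
  rewrite -multinomial_weight_del//.
  have : multinomial_weight b (del_user y r) <= a * l r.
    rewrite -lee_fin; apply: le_trans (IH r yr) _.
    have := lE r; rewrite /before (negPf yr) => e.
    by rewrite EFinM e muleA -EFinM divff ?gt_eqF// mul1e.
  move=> h; have := ler_wpM2l (b0 r) h; move=> /(ler_wpM2r (ltW N0)).
  by move=> /le_trans; apply; rewrite le_eqVlt; apply/orP; left; apply/eqP; ring.
have : \sum_r (y r)%:R * multinomial_weight b y <=
    \sum_r (\sum_s y s)%N%:R * a * (b r * l r) by apply: ler_sum.
rewrite -mulr_suml -natr_sum -mulr_sumr -mulrA ler_pM2l// => /le_trans; apply.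
by rewrite -[X in _ <= X]mulr1 ler_pM2l// bC.
Qed.

Hypothesis C_convex : convex_set C.

(** In [balance_ge], the factors [y_r^(y_r) / y_r!] give [exp (y_r)] up to [e (y_r + 1)], and
    [N! / (N+1)^N] gives [exp (- N - 1)]. The exponentials of [N] cancel, which leaves
    [exp (- <g, y>)] and the displayed polynomial loss. *)
Lemma balance_ge_support (y : state U) (D : R) : log_capacity C !=set0 ->
  support_K C (vec_of R y) = D%:E ->
  ((expR (- D - 1 - \sum_r (1 + ln (y r).+1%:R)))%:E <= balance C y)%E.
Proof.
move=> K0 DE; have fin : (support_K C (vec_of R y) < +oo)%E by rewrite DE ltry.
have [g Kg gC] := log_capacity_near_optimal C_nonneg C_convex C_nonincreasing K0 fin.
set N := (\sum_r y r)%N in gC.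
have N0 : 0 < N.+1%:R :> R by rewrite ltr0n.
pose b r : R := (y r)%:R * expR (- g r) / N.+1%:R.
apply: le_trans (@balance_ge b y _ _); last 2 first.
- by move=> r; rewrite /b !mulr_ge0 ?expR_ge0 ?invr_ge0 ?(ltW N0).
- move=> m /gC h.
  rewrite (eq_bigr (fun r => N.+1%:R^-1 * ((y r)%:R * (m r * expR (- g r))))); last first.
    by move=> r _; rewrite /b; ring.
  by rewrite -mulr_sumr mulrC ler_pdivrMr// mul1r.
rewrite lee_fin /multinomial_weight -/N.
have gD : inner g (vec_of R y) <= D by have := support_K_ge (vec_of R y) Kg; rewrite DE lee_fin.
have term r : expR (- (g r * (y r)%:R) + (y r)%:R - (1 + ln (y r).+1%:R)) * N.+1%:R ^- y r <=
    b r ^+ y r / (y r)`!%:R.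
  have f0 : 0 < (y r)`!%:R :> R by rewrite ltr0n fact_gt0.
  have s0 : 0 < (y r).+1%:R :> R by rewrite ltr0n.
  rewrite /b expr_div_n exprMn -expRM_natr mulNr.
  rewrite expRB !expRD lnK ?posrE//.
  rewrite ler_pdivlMr// mulrAC ler_wpM2r ?invr_ge0 ?exprn_ge0 ?(ltW N0)//.
  rewrite mulrAC ler_pdivrMr ?mulr_gt0 ?expR_gt0//.
  have := factorial_le R (y r) => /(ler_wpM2l (expR_ge0 (- (g r * (y r)%:R)))).
  move=> /le_trans h; rewrite -mulrA (mulrC (expR (y r)%:R)).
  by apply: h; rewrite le_eqVlt; apply/orP; left; apply/eqP; ring.
have : \prod_r (expR (- (g r * (y r)%:R) + (y r)%:R - (1 + ln (y r).+1%:R)) * N.+1%:R ^- y r) <=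
    \prod_r (b r ^+ y r / (y r)`!%:R).
  apply: ler_prod => r _; rewrite term andbT mulr_ge0 ?expR_ge0// invr_ge0 exprn_ge0// ltW.
rewrite big_split/= -expR_sum prodfV prodrXr -/N.
have f0 : 0 < N`!%:R :> R by rewrite ltr0n fact_gt0.
move=> /(ler_wpM2l (ltW f0)); apply: le_trans.
have p0 : 0 < N.+1%:R ^+ N :> R by rewrite exprn_gt0.
rewrite mulrA ler_pdivlMr//.
apply: le_trans (ler_wpM2l (expR_ge0 _) (exprSn_le_factorial R N)) _.
rewrite mulrCA ler_wpM2l ?(ltW f0)// -expRD ler_expR.
have -> : \sum_r (- (g r * (y r)%:R) + (y r)%:R - (1 + ln (y r).+1%:R)) =
    - inner g (vec_of R y) + N%:R - \sum_r (1 + ln (y r).+1%:R).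
  rewrite sumrB big_split /= sumrN -natr_sum.
  by congr (- _ + _ - _); apply: eq_bigr => r _; rewrite ffunE.
rewrite -natr1; by lra.
Qed.

End Balance.

(** * Rescaling *)

Section Scaling.
Variables (R : realType) (U : finType).

Lemma cvg_sublinear (u : nat -> R) (b E : R) :
  (\forall n \near \oo, `|u n - n%:R * b| <= E * (1 + ln n%:R)) ->
  n%:R^-1 * u n @[n --> \oo] --> b.
Proof.
(* For [E <= 0] the sequence eventually equals [n b]; for [E > 0] the error after division by [n] is
   compared with [2 E / sqrt n]. *)
move=> uE; have [E0|E0] := leP E 0.
  apply: cvg_near_cst; near=> n.
  have n1 : (0 < n)%N by near: n; exact: nbhs_infty_gt.
  have l0 : 0 <= 1 + ln n%:R :> R by rewrite addr_ge0// ln_ge0// ler1n.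
  have : `|u n - n%:R * b| <= 0.
    apply: (@le_trans _ _ (E * (1 + ln n%:R))); last by rewrite mulr_le0_ge0.
    by near: n.
  rewrite normr_le0 subr_eq0 => /eqP ->.
  by rewrite mulrA mulVf ?mul1r// pnatr_eq0 -lt0n.
have c0 : 2 * E * Num.sqrt (n%:R^-1) @[n --> \oo] --> 0.
  rewrite -(mulr0 (2 * E)); apply: cvgMr; rewrite -[X in _ --> X]sqrtr0.
  apply: continuous_cvg; first exact: sqrt_continuous.
  rewrite -(@cvg_shiftS _ (fun n => n%:R^-1 : R)); exact: cvg_harmonic.
suff : (fun n => n%:R^-1 * u n - b) @ \oo --> 0.
  move=> /(cvgD (cvg_cst b)); rewrite addr0; apply: cvg_trans.
  by apply: near_eq_cvg; near=> n => /=; rewrite addrC subrK.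
apply/norm_cvg0P; apply: squeeze_cvgr c0; last exact: cvg_cst.
near=> n; rewrite normr_ge0/=.
have n1 : (0 < n)%N by near: n; exact: nbhs_infty_gt.
have n0 : 0 < n%:R :> R by rewrite ltr0n.
have -> : n%:R^-1 * u n - b = n%:R^-1 * (u n - n%:R * b).
  by rewrite mulrBr mulrA mulVf ?mul1r// gt_eqF.
rewrite normrM gtr0_norm ?invr_gt0// mulrC ler_pdivrMr//.
apply: (@le_trans _ _ (E * (1 + ln n%:R))); first by near: n.
have s0 : 0 < Num.sqrt n%:R :> R by rewrite sqrtr_gt0.
rewrite -(mulrA (2 * E)); have -> : Num.sqrt n%:R^-1 * n%:R = Num.sqrt n%:R :> R.
  rewrite -[X in _ * X](@sqr_sqrtr _ n%:R) ?ltW// sqrtrV ?ltW// expr2 mulrA.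
  by rewrite mulVf ?mul1r// gt_eqF.
rewrite -mulrA mulrCA ler_pM2l//.
(* [ln n = 2 ln (sqrt n) <= 2 (sqrt n - 1)], so [1 + ln n <= 2 sqrt n]. *)
rewrite -[X in ln X](@sqr_sqrtr _ n%:R) ?ltW// lnXn// mulr2n.
have : ln (1 + (Num.sqrt n%:R - 1)) <= Num.sqrt n%:R - 1 :> R.
  by apply: le_ln1Dx; lra.
by rewrite addrCA subrr addr0; lra.
Unshelve. all: by end_near.
Qed.

Lemma scaled_state_bounds (n : nat) (x : vec R U) r : 0 <= x r ->
  n%:R * x r - 1 < (scaled_state n x r)%:R <= n%:R * x r.
Proof.
move=> x0; have h : 0 <= n%:R * x r by rewrite mulr_ge0.
rewrite ffunE; have /andP[h1 h2] := truncn_itv h.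
by rewrite h1 andbT ltrBlDr natr1.
Qed.

Lemma inner_scaled_state (g x : vec R U) (n : nat) : (forall r, 0 <= x r) ->
  `|inner g (vec_of R (scaled_state n x)) - n%:R * inner g x| <= \sum_r `|g r|.
Proof.
move=> x0; rewrite /inner mulr_sumr -sumrB.
apply: le_trans (ler_norm_sum _ _ _) _; apply: ler_sum => r _.
have /andP[h1 h2] := scaled_state_bounds n (x0 r).
rewrite [vec_of _ _ _]ffunE mulrCA -mulrBr normrM -[X in _ <= X]mulr1 ler_wpM2l//.
by rewrite ler_norml; apply/andP; split; lra.
Qed.

(** The polynomial loss of [balance_ge_support] costs only [O(ln n)] on the logarithmic scale,
    because [floor (n x_r) + 1 <= n (x_r + 1)]. *)
Lemma sum_ln_scaled_state (x : vec R U) (n : nat) : (forall r, 0 <= x r) ->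
  (0 < n)%N ->
  0 <= \sum_r (1 + ln (scaled_state n x r).+1%:R : R) <=
    (\sum_r (1 + ln (x r + 1))) * (1 + ln n%:R).
Proof.
move=> x0 n1; have n0 : 0 < n%:R :> R by rewrite ltr0n.
have l0 : 0 <= ln n%:R :> R by rewrite ln_ge0// ler1n.
apply/andP; split.
  by apply: sumr_ge0 => r _; rewrite addr_ge0// ln_ge0// ler1n.
rewrite mulr_suml; apply: ler_sum => r _.
have /andP[_ h] := scaled_state_bounds n (x0 r).
have lx : 0 <= ln (x r + 1) by rewrite ln_ge0// lerDr.
have n1' : 1 <= n%:R :> R by rewrite ler1n.
have : ln (scaled_state n x r).+1%:R <= ln (n%:R * (x r + 1)) :> R.
  rewrite ler_ln ?posrE ?ltr0n ?mulr_gt0 ?ltr_wpDl//.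
  by rewrite -natr1; lra.
rewrite lnM ?posrE ?ltr_wpDl// => h'.
by nra.
Qed.

Variable C : set (vec R U).
Hypothesis C_convex : convex_set C.
Hypothesis C_nonincreasing : nonincreasing_capacity C.

(* [max (exp (g r)) (exp (h r)) / 2] is below the midpoint of [exp g] and [exp h]. *)
Lemma log_capacity_average (g h : vec R U) : log_capacity C g -> log_capacity C h ->
  log_capacity C [ffun r => Num.max (g r) (h r) - ln 2].
Proof.
move=> Kg Kh.
have t0 : 0 <= 2^-1 :> R by rewrite invr_ge0.
have t1 : 2^-1 <= 1 :> R by lra.
have := capacity_segment C_convex t0 t1 Kg Kh.
apply: C_nonincreasing => r; rewrite !ffunE ?expR_ge0//.
  by rewrite addr_ge0 ?mulr_ge0 ?expR_ge0//; lra.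
rewrite expRB lnK ?posrE//.
have := expR_ge0 (g r); have := expR_ge0 (h r).
by case: (leP (g r) (h r)) => _ *; lra.
Qed.

(** Averaging [g] with a fixed [g0] in [K] bounds the other coordinates from below, so [<., x> <= D]
    bounds [g r] from above; [F r] is the resulting bound. *)
Lemma log_capacity_bounded (x : vec R U) (D : R) : log_capacity C !=set0 ->
  (forall r, 0 <= x r) -> support_K C x = D%:E ->
  exists2 M, 0 <= M & forall g r, log_capacity C g -> 0 < x r -> g r <= M.
Proof.
move=> [g0 Kg0] x0 DE.
pose F r := ln 2 + (D - \sum_(s | s != r) (g0 s - ln 2) * x s) / x r.
exists (\sum_r `|F r|); first by apply: sumr_ge0.
move=> g r Kg xr.
apply: (@le_trans _ _ `|F r|); last first.
  by rewrite (bigD1 r)//= lerDl sumr_ge0.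
apply: le_trans (ler_norm _); rewrite -lerBlDl ler_pdivlMr//.
have := support_K_ge x (log_capacity_average Kg Kg0); rewrite DE lee_fin.
rewrite /inner (bigD1 r)//= ffunE => h.
have h1 : (g r - ln 2) * x r <= (Num.max (g r) (g0 r) - ln 2) * x r.
  by rewrite ler_wpM2r// lerD2r le_max lexx.
have h2 : \sum_(s | s != r) (g0 s - ln 2) * x s <=
    \sum_(s | s != r) [ffun r => Num.max (g r) (g0 r) - ln 2] s * x s.
  by apply: ler_sum => s _; rewrite ffunE ler_wpM2r// lerD2r le_max lexx orbT.
by lra.
Qed.

(** By homogeneity the support function at [n x] is [n D]; rounding costs [O(1)]. Elements of [K]
    may be unbounded below, so each comparison is arranged to leave a nonnegative remainder, where
    the upper bound [M] suffices. *)
Lemma support_K_scaled_state (x : vec R U) (D : R) : log_capacity C !=set0 ->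
  (forall r, 0 <= x r) -> support_K C x = D%:E ->
  exists B : R, \forall n \near \oo, exists2 d : R,
    support_K C (vec_of R (scaled_state n x)) = d%:E & `|d - n%:R * D| <= B.
Proof.
move=> K0 x0 DE.
have [M M0 gM] := log_capacity_bounded K0 x0 DE.
have leD g : log_capacity C g -> inner g x <= D.
  by move=> /support_K_ge -/(_ x); rewrite DE lee_fin.
(* With this [c], the unit lost by rounding is at most [c x_r] wherever [x_r > 0]. *)
have [c c0 cx] : exists2 c, 0 <= c & forall r, 0 < x r -> 1 <= c * x r.
  exists (\sum_r (x r)^-1); first by apply: sumr_ge0 => r _; rewrite invr_ge0.
  move=> r xr; rewrite -ler_pdivrMr// mul1r (bigD1 r)//= lerDl.
  by apply: sumr_ge0 => s _; rewrite invr_ge0.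
pose B1 := M * c * (\sum_r x r) - c * D; pose B2 := \sum_(r : U) M.
exists (`|B1| + `|B2|).
near=> n; set y := scaled_state n x.
have nc : c <= n%:R by near: n; exact: nbhs_infty_ger.
have low r : (n%:R - c) * x r <= (y r)%:R <= n%:R * x r.
  have /andP[/ltW h1 ->] := scaled_state_bounds n (x0 r).
  rewrite andbT; have := x0 r; rewrite le_eqVlt => /predU1P[<-|/cx]; first by rewrite mulr0.
  by move: h1; rewrite -/y; lra.
have yx r : x r = 0 -> (y r)%:R = 0 :> R.
  by move=> e; have := low r; rewrite e !mulr0 => h; apply/eqP; rewrite eq_le andbC.
(* On the support of [x], [y] lies between [(n - c) x] and [n x]. *)
have upper_term (a b e : R) : a <= M -> (n%:R - c) * b <= e -> e <= n%:R * b ->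
    a * e <= (n%:R - c) * (a * b) + M * c * b.
  move=> aM e1 e2.
  have : a * (e - (n%:R - c) * b) <= M * (e - (n%:R - c) * b).
    by rewrite ler_wpM2r// subr_ge0.
  have : M * (e - (n%:R - c) * b) <= M * (c * b) by rewrite ler_wpM2l//; lra.
  by lra.
have lower_term (a b e : R) : a <= M -> n%:R * b - 1 < e -> e <= n%:R * b ->
    n%:R * (a * b) <= a * e + M.
  move=> aM e1 e2.
  have : a * (n%:R * b - e) <= M * (n%:R * b - e) by rewrite ler_wpM2r// subr_ge0.
  have : M * (n%:R * b - e) <= M * 1 by rewrite ler_wpM2l//; lra.
  by lra.
have upper : (support_K C (vec_of R y) <= (n%:R * D + B1)%:E)%E.
  apply: support_K_le => g Kg; rewrite lee_fin.
  apply: (@le_trans _ _ ((n%:R - c) * inner g x + M * c * (\sum_r x r))); last first.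
    have : (n%:R - c) * inner g x <= (n%:R - c) * D by rewrite ler_wpM2l ?subr_ge0 ?leD.
    by rewrite /B1; lra.
  rewrite /inner !mulr_sumr -big_split/=; apply: ler_sum => r _; rewrite ffunE.
  have [xr|xr] := eqVneq (x r) 0; first by rewrite yx// xr !mulr0 addr0.
  have xr0 : 0 < x r by rewrite lt_neqAle eq_sym xr x0.
  by have /andP[h1 h2] := low r; exact: (@upper_term (g r) (x r) (y r)%:R (gM g r Kg xr0) h1 h2).
have yfin : support_K C (vec_of R y) \is a fin_num.
  case: K0 => g Kg; rewrite fin_numElt (le_lt_trans upper) ?ltry// andbT.
  by rewrite (lt_le_trans _ (support_K_ge _ Kg)) ?ltNyr.
have [d dE] : exists d, support_K C (vec_of R y) = d%:E.
  by exists (fine (support_K C (vec_of R y))); rewrite fineK.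
exists d => //.
have h1 : d <= n%:R * D + B1 by move: upper; rewrite dE lee_fin.
have n0 : 0 < n%:R :> R by rewrite ltr0n; near: n; exact: nbhs_infty_gt.
have h2 : n%:R * D <= d + B2.
  rewrite mulrC -ler_pdivlMr// -lee_fin -DE; apply: support_K_le => g Kg.
  rewrite lee_fin ler_pdivlMr// mulrC.
  have : inner g (vec_of R y) <= d.
    by have := support_K_ge (vec_of R y) Kg; rewrite dE lee_fin.
  suff : n%:R * inner g x <= inner g (vec_of R y) + B2 by lra.
  rewrite /inner !mulr_sumr -big_split/=; apply: ler_sum => r _; rewrite ffunE.
  have [xr|xr] := eqVneq (x r) 0; first by rewrite yx// xr !mulr0 add0r.
  have xr0 : 0 < x r by rewrite lt_neqAle eq_sym xr x0.
  by have /andP[h3 h4] := scaled_state_bounds n (x0 r); exact: (@lower_term (g r) (x r) (y r)%:R (gM g r Kg xr0) h3 h4).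
have := ler_norm B1; have := ler_norm B2; have := normr_ge0 B1; have := normr_ge0 B2.
by rewrite ler_norml => *; apply/andP; split; lra.
Unshelve. all: by end_near.
Qed.

End Scaling.

Lemma esumZl_gt0 (R : realType) (T : choiceType) (A : set T) (c : R)
    (f : T -> \bar R) : 0 < c -> (forall i, 0 <= f i)%E ->
  (\esum_(i in A) (c%:E * f i) = c%:E * \esum_(i in A) f i)%E.
Proof.
(* The reverse inequality is this one applied to [c^-1] and [c f]. *)
have le (c' : R) (f' : T -> \bar R) : 0 < c' -> (forall i, 0 <= f' i)%E ->
    (\esum_(i in A) (c'%:E * f' i) <= c'%:E * \esum_(i in A) f' i)%E.
  move=> c0 f0; apply: ge_ereal_sup => _ [X AX <-].
  rewrite -ge0_mule_fsumr// lee_pmul2l// ?lte_fin//.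
  by apply: esum_ge; exists X.
move=> c0 f0; apply/eqP; rewrite eq_le le//=.
have ci0 : 0 < c^-1 by rewrite invr_gt0.
have cf0 i : (0 <= c%:E * f i)%E by rewrite mule_ge0// lee_fin ltW.
rewrite -(@lee_pmul2l _ c^-1%:E)// ?lte_fin//.
rewrite muleA -EFinM mulVf ?gt_eqF// mul1e; apply: le_trans (le _ _ ci0 cf0).
by apply: le_esum => i _; rewrite muleA -EFinM mulVf ?gt_eqF// mul1e.
Qed.

Lemma le_normalization (R : realType) (U : finType) (w : state U -> \bar R) y :
  (w y <= normalization w)%E.
Proof. by apply: esum_ge; exists [set y]; [split | rewrite fsbig_set1]. Qed.

(** * Large deviations and stationarity *)

Section LargeDeviations.
Variables (R : realType) (U : finType) (C : set (vec R U)) (rho : U -> R).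
(** Both allocations are treated at once: [v] stands for [ln psi] under balanced fairness and for
    minus the support function under PF', and [w] for the unnormalized weight. *)
Variables v w : state U -> \bar R.
Local Notation log_rho := ([ffun r => ln (rho r)] : vec R U).

Hypothesis C_convex : convex_set C.
Hypothesis C_nonincreasing : nonincreasing_capacity C.
Hypothesis K0 : log_capacity C !=set0.
Hypothesis v_le : forall y, (v y <= - support_K C (vec_of R y))%E.
Hypothesis v_ge : forall y D, support_K C (vec_of R y) = D%:E ->
  ((- D - 1 - \sum_r (1 + ln (y r).+1%:R))%:E <= v y)%E.
Hypothesis wE : forall y, w y = expeR (v y + (inner log_rho (vec_of R y))%:E)%E.
Hypothesis w_fin : (normalization w < +oo)%E.

Lemma support_K0 : support_K C (vec_of R [ffun=> 0%N]) = 0%E.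
Proof.
have i0 (g : vec R U) : inner g (vec_of R [ffun=> 0%N]) = 0.
  by rewrite /inner big1// => r _; rewrite !ffunE mulr0.
apply/eqP; rewrite eq_le; apply/andP; split.
  by apply: support_K_le => g _; rewrite i0.
by case: K0 => g /support_K_ge -/(_ (vec_of R [ffun=> 0%N])); rewrite i0.
Qed.

Lemma weight_ge0 y : (0 <= w y)%E.
Proof. by rewrite wE expeR_ge0. Qed.

Lemma normalization_gt0 : (0 < normalization w)%E.
Proof.
apply: lt_le_trans (le_normalization w [ffun=> 0%N]).
rewrite wE; apply: expeR_gt0.
apply: (@lt_le_trans _ _ ((- 0 - 1 - \sum_r (1 + ln ([ffun=> 0%N] r : nat).+1%:R))%:E +
  (inner log_rho (vec_of R [ffun=> 0%N]))%:E)%E); first by rewrite -EFinD ltNyr.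
by apply: leeD2r; exact: (v_ge support_K0).
Qed.

Lemma normalization_fin : exists2 z : R, 0 < z & normalization w = z%:E.
Proof.
exists (fine (normalization w)); last by rewrite fineK// gt0_fin_numE// normalization_gt0.
by rewrite fine_gt0// normalization_gt0 w_fin.
Qed.

Lemma esum_normalized : \esum_(x in [set: state U]) normalized w x = 1%E.
Proof.
have [z z0 zE] := normalization_fin.
rewrite /normalized zE inver gt_eqF// esumZl_gt0 ?invr_gt0//; last exact: weight_ge0.
by rewrite -/(normalization w) zE -EFinM mulVf// gt_eqF.
Qed.

Lemma large_deviations_normalized : large_deviations (normalized w) (lyapunov C rho).
Proof.
move=> x x0; have [z z0 zE] := normalization_fin.
have lnpE y : lne (normalized w y) =
    ((- ln z)%:E + (v y + (inner log_rho (vec_of R y))%:E))%E.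
  rewrite /normalized zE inver gt_eqF// wE.
  have -> : (z^-1)%:E = expeR (- ln z)%:E by rewrite /= expRN lnK// posrE.
  by rewrite -expeRD expeRK.
under eq_fun do rewrite lnpE.
rewrite /lyapunov.
have -> : \sum_r ln (rho r) * x r = inner log_rho x.
  by apply: eq_bigr => r _; rewrite ffunE.
have nN (a : R) : - a <= `|a| by rewrite -normrN ler_norm.
have E0 : 0 <= \sum_r `|log_rho r| by apply: sumr_ge0.
have l1 n : (0 < n)%N -> 1 <= 1 + ln n%:R :> R.
  by move=> n0; rewrite lerDl ln_ge0// ler1n.
have sup_gtNy : (-oo < support_K C x)%E.
  by case: K0 => g Kg; rewrite (lt_le_trans _ (support_K_ge _ Kg)) ?ltNyr.
(* If the support function is finite at [x], the logarithm of the weight is squeezed between two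
   explicit sequences with error [O(ln n)]. *)
case DE : (support_K C x) sup_gtNy => [D| |] // _.
- have [B hB] := support_K_scaled_state C_convex C_nonincreasing K0 x0 DE.
  set E1 := \sum_r `|log_rho r| in E0.
  pose E2 := \sum_r (1 + ln (x r + 1)).
  pose E := `|ln z| + `|B| + 1 + `|E2| + E1.
  pose S n := inner log_rho (vec_of R (scaled_state n x)).
  pose L n := \sum_r (1 + ln (scaled_state n x r).+1%:R) : R.
  pose lower n := - ln z - (n%:R * D + B) - 1 - L n + S n.
  pose upper n := - ln z - (n%:R * D - B) + S n.
  have bnd n : (0 < n)%N -> `|lower n - n%:R * (- D + inner log_rho x)| <= E * (1 + ln n%:R) /\
      `|upper n - n%:R * (- D + inner log_rho x)| <= E * (1 + ln n%:R).
    move=> n0; have := inner_scaled_state log_rho n x0; rewrite -/(S n) -/E1.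
    have /andP[L0 L2] := sum_ln_scaled_state x0 n0; rewrite -/(L n) -/E2 in L0 L2.
    have {}L2 : L n <= `|E2| * (1 + ln n%:R).
      apply: le_trans L2 _; rewrite ler_wpM2r ?ler_norm//.
      by rewrite (le_trans ler01)// l1.
    have : `|ln z| + `|B| + 1 + E1 <= (`|ln z| + `|B| + 1 + E1) * (1 + ln n%:R).
      by rewrite ler_peMr ?l1// !addr_ge0.
    rewrite !ler_norml => h1 /andP[h2 h3].
    have : E * (1 + ln n%:R) = (`|ln z| + `|B| + 1 + E1) * (1 + ln n%:R) + `|E2| * (1 + ln n%:R).
      by rewrite /E; ring.
    move=> ->; have := ler_norm (ln z); have := nN (ln z).
    have := ler_norm B; have := nN B.
    by rewrite /lower /upper; split; apply/andP; split; lra.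
  have cvgl : (n%:R^-1 * lower n)%:E @[n --> \oo] --> (- (D - inner log_rho x))%:E.
    rewrite opprB addrC; apply: cvg_EFin; first by near=> n.
    apply: (@cvg_sublinear _ _ _ E).
    near=> n; have n0 : (0 < n)%N by near: n; exact: nbhs_infty_gt.
    by case: (bnd n n0).
  have cvgu : (n%:R^-1 * upper n)%:E @[n --> \oo] --> (- (D - inner log_rho x))%:E.
    rewrite opprB addrC; apply: cvg_EFin; first by near=> n.
    apply: (@cvg_sublinear _ _ _ E).
    near=> n; have n0 : (0 < n)%N by near: n; exact: nbhs_infty_gt.
    by case: (bnd n n0).
  refine (squeeze_cvge _ cvgl cvgu).
  near=> n; have n0 : (0 < n)%N by near: n; exact: nbhs_infty_gt.
  have [d dE dB] : exists2 d : R, support_K C (vec_of R (scaled_state n x)) = d%:E &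
      `|d - n%:R * D| <= B by near: n.
  move: dB; rewrite ler_norml => /andP[d1 d2].
  have ni0 : (0 < n%:R^-1%:E :> \bar R)%E by rewrite lte_fin invr_gt0 ltr0n.
  have := v_le (scaled_state n x); have := v_ge dE; rewrite dE.
  case: (v (scaled_state n x)) => [q| |]; rewrite ?leeNy_eq ?leye_eq//.
  rewrite -EFinN !lee_fin -/(L n) -/(S n) => q1 q2.
  by rewrite !ler_pM2l ?invr_gt0 ?ltr0n// /lower /upper; apply/andP; split; lra.
(* Each [g] in [K] bounds the exponent by a sequence tending to a finite limit,
   and that limit is arbitrarily low. *)
- apply/cvgeNyPle => A.
  have [g Kg gA] : exists2 g, log_capacity C g & inner log_rho x - A + 1 < inner g x.
    apply: contrapT => H.
    suff : (support_K C x <= (inner log_rho x - A + 1)%:E)%E by rewrite DE leye_eq.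
    apply: support_K_le => g Kg; rewrite lee_fin leNgt; apply/negP => lt.
    by apply: H; exists g.
  pose u n := - ln z - inner g (vec_of R (scaled_state n x)) +
    inner log_rho (vec_of R (scaled_state n x)).
  have cu : n%:R^-1 * u n @[n --> \oo] --> - inner g x + inner log_rho x.
    apply: (@cvg_sublinear _ _ _ (`|ln z| + \sum_r `|g r| + \sum_r `|log_rho r|)).
    near=> n; have n0 : (0 < n)%N by near: n; exact: nbhs_infty_gt.
    have G0 : 0 <= \sum_r `|g r| by apply: sumr_ge0.
    apply: (@le_trans _ _ (`|ln z| + \sum_r `|g r| + \sum_r `|log_rho r|)); last first.
      by rewrite ler_peMr ?l1// !addr_ge0.
    have := inner_scaled_state log_rho n x0; have := inner_scaled_state g n x0.
    have := ler_norm (ln z); have := nN (ln z).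
    rewrite /u !ler_norml => h1 h2 /andP[h3 h4] /andP[h5 h6].
    by apply/andP; split; lra.
  have lt0 : 0 < A - (- inner g x + inner log_rho x) by lra.
  have near_u := cvgr_le (- inner g x + inner log_rho x) cu.
  near=> n; have n0 : (0 < n)%N by near: n; exact: nbhs_infty_gt.
  have uA : n%:R^-1 * u n <= A.
    by near: n; apply: near_u; lra.
  apply: (@le_trans _ _ ((n%:R^-1)%:E * (u n)%:E)%E); last by rewrite -EFinM lee_fin.
  rewrite lee_pmul2l ?lte_fin ?invr_gt0 ?ltr0n//.
  have vg : (v (scaled_state n x) <= (- inner g (vec_of R (scaled_state n x)))%:E)%E.
    by apply: le_trans (v_le _) _; rewrite EFinN leeN2 support_K_ge.
  rewrite /u -addrA !EFinD leeD2l// leeD2r//.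
Unshelve. all: by end_near.
Qed.

End LargeDeviations.

(** * Detailed balance and stationary distributions *)

Section Stationarity.
Variables (R : realType) (U : finType) (nu mu : U -> R).
Hypothesis nu_gt0 : forall r, 0 < nu r.
Hypothesis mu_gt0 : forall r, 0 < mu r.

Lemma stationary_detailed_balance (lambda : state U -> U -> \bar R)
    (p : state U -> \bar R) :
  (forall x r, (0 <= lambda x r)%E) ->
  (forall x, exists2 q : R, 0 < q & p x = q%:E) ->
  \esum_(x in [set: state U]) p x = 1%E ->
  (forall x r, p x * (nu r)%:E =
    p (add_user x r) * ((mu r)%:E * lambda (add_user x r) r))%E ->
  stationary_distribution nu mu lambda p.
Proof.
move=> l0 p_gt0 p1 balanced.
have nu0 r : (0 <= (nu r)%:E)%E by rewrite lee_fin ltW.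
have ml0 x r : (0 <= (mu r)%:E * lambda x r)%E by rewrite mule_ge0// lee_fin ltW.
have s1 x y : (0 <= \sum_(r | y == add_user x r) (nu r)%:E)%E by apply: sume_ge0.
have s2 x y : (0 <= \sum_(r | x == add_user y r) (mu r)%:E * lambda x r)%E.
  by apply: sume_ge0.
have rev x y : (p x * jump_rate nu mu lambda x y = p y * jump_rate nu mu lambda y x)%E.
  (* Arrivals from [a] to [b] match departures from [b] to [a]; exchanging the states swaps the two
     sums of [jump_rate]. *)
  have half a b : (p a * \sum_(r | b == add_user a r) (nu r)%:E =
      p b * \sum_(r | b == add_user a r) (mu r)%:E * lambda b r)%E.
    rewrite !ge0_sume_distrr//; apply: eq_bigr => r /eqP ->; exact: balanced.
  rewrite /jump_rate !ge0_muleDr//; rewrite half [RHS]addeC; congr (_ + _)%E.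
  by rewrite half.
split=> //; first by move=> x; have [q q0 ->] := p_gt0 x; rewrite lee_fin ltW.
move=> y; have [q q0 qE] := p_gt0 y.
rewrite qE -esumZl_gt0//; last by move=> z; rewrite /jump_rate adde_ge0.
by apply: eq_esum => x _; rewrite rev qE.
Qed.

Lemma add_userK (x : state U) r : del_user (add_user x r) r = x.
Proof. by apply/ffunP => s; rewrite !ffunE addnK. Qed.

Lemma add_user_neq0 (x : state U) r : add_user x r r != 0%N.
Proof. by rewrite ffunE eqxx addn1. Qed.

(** An allocation that is a ratio of values of [u] makes the process reversible: adding a user of
    type [r] multiplies the weight by [rho_r] times the inverse of that ratio. *)
Lemma stationary_product_form (lambda : state U -> U -> \bar R)
    (u : state U -> R) (w : state U -> \bar R) (z : R) :
  0 < z -> normalization w = z%:E -> \esum_(x in [set: state U]) normalized w x = 1%E ->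
  (forall x, 0 < u x) -> (forall x r, (0 <= lambda x r)%E) ->
  (forall x r, lambda (add_user x r) r = (u x / u (add_user x r))%:E) ->
  (forall x, w x =
    (u x * expR (inner [ffun r => ln (nu r / mu r)] (vec_of R x)))%:E) ->
  stationary_distribution nu mu lambda (normalized w).
Proof.
move=> z0 zE tot u0 l0 lE wE.
have pE x : normalized w x =
    (z^-1 * (u x * expR (inner [ffun r => ln (nu r / mu r)] (vec_of R x))))%:E.
  by rewrite /normalized zE inver gt_eqF// wE.
apply: stationary_detailed_balance => //.
  by move=> x; eexists; last exact: pE; rewrite !mulr_gt0 ?invr_gt0 ?expR_gt0.
move=> x r.
rewrite !pE lE -!EFinM; congr EFin.
rewrite (inner_del_user _ (add_user_neq0 x r)) add_userK ffunE expRD lnK; last first.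
  by rewrite posrE divr_gt0.
by field; rewrite !gt_eqF.
Qed.

End Stationarity.

(** * Nonemptiness of [K] from a finite normalization *)

Section NonemptyInterior.
Variables (R : realType) (U : finType) (C : set (vec R U)) (rho : U -> R).
Hypothesis C_nonempty : C !=set0.
Hypothesis C_nonneg : forall l : vec R U, C l -> forall r, 0 <= l r.
Hypothesis C_convex : convex_set C.

(** For empty [K] the support function is [-oo], so already the empty state has infinite weight. *)
Lemma log_capacity_of_weight_PF' :
  (normalization (weight_PF' C rho) < +oo)%E -> log_capacity C !=set0.
Proof.
move=> fin; apply/set0P/eqP => K0; move: fin; apply/negP; rewrite -leNgt.
apply: le_trans (le_normalization _ [ffun=> 0%N]).
have suppE : support_K C (vec_of R [ffun=> 0%N]) = -oo%E.
  by apply/eqP; rewrite -leeNy_eq; apply: support_K_le => g; rewrite K0.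
by rewrite /weight_PF' /lyapunov suppE.
Qed.

(** If no point of [C] has a positive [r]-th coordinate, then [psi (e_r)] is the infimum of the
    empty set, and the state [e_r] has infinite weight. *)
Lemma log_capacity_of_weight_BF :
  (normalization (weight_BF C rho) < +oo)%E -> log_capacity C !=set0.
Proof.
move=> fin; apply: log_capacity_exists => // r; apply: contrapT => H.
move: fin; apply/negP; rewrite -leNgt.
apply: le_trans (le_normalization _ (add_user [ffun=> 0%N] r)).
suff balE : balance C (add_user [ffun=> 0%N] r) = +oo%E.
  by rewrite /weight_BF /phi balE.
have nz : add_user [ffun=> 0%N] r != [ffun=> 0%N].
  by apply/eqP => /ffunP/(_ r); rewrite !ffunE eqxx.
rewrite balanceE//; apply/eqP; rewrite -leye_eq.
apply: le_ereal_inf_tmp => b [a [a0 [l Cl lE]] _]; exfalso; apply: H; exists l => //.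
have := lE r; rewrite /before (negPf (add_user_neq0 _ _)) add_userK balance0 mule1.
by move=> [->]; rewrite invr_gt0.
Qed.

End NonemptyInterior.

Theorem corollary2 (R : realType) (U : finType) (C : set (vec R U))
    (nu mu : U -> R)
    (C_nonempty : C !=set0)
    (C_nonneg : forall l : vec R U, C l -> forall r, 0 <= l r)
    (C_convex : convex_set C)
    (C_nonincreasing : nonincreasing_capacity C)
    (nu_gt0 : forall r, 0 < nu r) (mu_gt0 : forall r, 0 < mu r) :
  let rho := fun r => nu r / mu r in
  ((normalization (weight_BF C rho) < +oo)%E ->
     large_deviations (pi_BF C rho) (lyapunov C rho) /\
     ((forall x, 0 < balance C x)%E ->
        stationary_distribution nu mu (lambda_BF C) (pi_BF C rho))) /\
  ((normalization (weight_PF' C rho) < +oo)%E ->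
     large_deviations (pi_PF' C rho) (lyapunov C rho) /\
     ((forall x, support_K C (vec_of R x) < +oo)%E ->
        stationary_distribution nu mu (lambda_PF' C) (pi_PF' C rho))).
Proof.
move=> rho.
have innerE (h : vec R U) (y : state U) :
    \sum_r (y r)%:R * h r = inner h (vec_of R y).
  by apply: eq_bigr => r _; rewrite ffunE mulrC.
split=> fin.
- have K0 := log_capacity_of_weight_BF C_nonempty C_nonneg C_convex fin.
  pose v y := lne (balance C y).
  have wE y : weight_BF C rho y =
      expeR (v y + (inner [ffun r => ln (rho r)] (vec_of R y))%:E)%E.
    rewrite /weight_BF /phi oppeK -innerE; congr (expeR (_ + _%:E))%E.
    by apply: eq_bigr => r _; rewrite ffunE.
  have v_le y : (v y <= - support_K C (vec_of R y))%E.
    rewrite leeNr; apply: support_K_le => g Kg; rewrite leeNr -EFinN.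
    rewrite -lee_expeR lneK ?in_itv/= ?leey ?andbT ?balance_ge0//.
    exact: balance_le.
  have v_ge y D : support_K C (vec_of R y) = D%:E ->
      ((- D - 1 - \sum_r (1 + ln (y r).+1%:R))%:E <= v y)%E.
    move=> DE; rewrite -lee_expeR lneK ?in_itv/= ?leey ?andbT ?balance_ge0//.
    exact: balance_ge_support.
  split; first exact: (large_deviations_normalized C_convex C_nonincreasing K0 v_le v_ge wE).
  move=> b0.
  have [z z0 zE] := normalization_fin K0 v_ge wE fin.
  (* Any element of [K] makes [psi] finite through [balance_le]; with positivity, [psi] itself
     serves as [u] in the product form. *)
  have bE y : balance C y = (fine (balance C y))%:E.
    case: (K0) => g Kg; rewrite fineK// ge0_fin_numE ?balance_ge0//.
    by rewrite (le_lt_trans (balance_le C_nonincreasing y Kg)) ?ltry.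
  have u0 y : 0 < fine (balance C y) by rewrite -lte_fin -bE.
  apply: (@stationary_product_form _ _ nu mu _ _ _ (fun y => fine (balance C y)) _ z) => //.
  + exact: (esum_normalized K0 v_ge wE fin).
  + by move=> x r; rewrite /lambda_BF mule_ge0 ?before_ge0// inve_ge0 balance_ge0.
  + move=> x r; rewrite /lambda_BF /before (negPf (add_user_neq0 _ _)) add_userK.
    by rewrite [in LHS]bE (bE (add_user x r)) inver gt_eqF// EFinM.
  + by move=> x; rewrite wE expeRD /v lneK ?in_itv/= ?leey ?andbT ?balance_ge0// EFinM -bE.
- have K0 := log_capacity_of_weight_PF' fin.
  pose v y := (- support_K C (vec_of R y))%E.
  have wE y : weight_PF' C rho y =
      expeR (v y + (inner [ffun r => ln (rho r)] (vec_of R y))%:E)%E.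
    rewrite /weight_PF' /lyapunov oppeB ?fin_num_adde_defl//.
    congr (expeR (_ + _%:E))%E.
    by apply: eq_bigr => r _; rewrite !ffunE.
  have v_le y : (v y <= - support_K C (vec_of R y))%E by [].
  have v_ge y D : support_K C (vec_of R y) = D%:E ->
      ((- D - 1 - \sum_r (1 + ln (y r).+1%:R))%:E <= v y)%E.
    move=> DE; rewrite /v DE -EFinN lee_fin.
    have : 0 <= \sum_r (1 + ln (y r).+1%:R) :> R.
      by apply: sumr_ge0 => r _; rewrite addr_ge0// ln_ge0// ler1n.
    by lra.
  split; first exact: (large_deviations_normalized C_convex C_nonincreasing K0 v_le v_ge wE).
  move=> sfin.
  have [z z0 zE] := normalization_fin K0 v_ge wE fin.
  have sE y : support_K C (vec_of R y) = (fine (support_K C (vec_of R y)))%:E.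
    case: (K0) => g Kg; rewrite fineK// fin_numElt sfin andbT.
    by rewrite (lt_le_trans _ (support_K_ge _ Kg)) ?ltNyr.
  (* Here [u] is [exp] of minus the support function, whose ratios are the PF' allocation. *)
  apply: (@stationary_product_form _ _ nu mu _ _ _
    (fun y => expR (- fine (support_K C (vec_of R y)))) _ z) => //.
  + exact: (esum_normalized K0 v_ge wE fin).
  + by move=> x; exact: expR_gt0.
  + by move=> x r; rewrite /lambda_PF'; case: ifP => // _; exact: expeR_ge0.
  + move=> x r; rewrite /lambda_PF' lt0n add_user_neq0 add_userK.
    rewrite [in LHS]sE (sE x) /= -expRB.
    by congr (expR _)%:E; ring.
  + by move=> x; rewrite wE /v [in LHS]sE /= expRD.
Qed.
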